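(* Let $t\colon X\to(\mathcal{P}X)^A$ be a labelled transition system with finite sets of successors, and let $\tilde t\colon X\to(\mathcal{P}\mathcal{D}X)^A$ be the NPLTS $\tilde t(x)(a)=\{\delta_{x'}\mid x'\in t(x)(a)\}$. Then the may-must, may and must trace equivalences of the LTS $t$ coincide, respectively, with the may-must trace equivalence $\equiv$, the may trace equivalence $\equiv_B$ and the must trace equivalence $\equiv_T$ of the NPLTS $\tilde t$.
   Context: LTS semantics: for a nonempty finite $S\subseteq X+\{\star\}$ and label $a$ let $S^a=\bigcup_{u\in S}\theta(u,a)$, where $\theta(\star,a)=\{\star\}$, $\theta(x,a)=\{\star\}$ if $t(x)(a)=\emptyset$ and $\theta(x,a)=t(x)(a)$ otherwise; $S^\varepsilon=S$, $S^{aw}=(S^a)^w$. Let $\mathrm{obs}(S)\subseteq\{\bullet,\star\}$ contain $\bullet$ iff $S\cap X\neq\emptyset$ and $\star$ iff $\star\in S$. LTS may-must trace equivalence: $x\equiv^{LTS}_*y$ iff $\mathrm{obs}(\{x\}^w)=\mathrm{obs}(\{y\}^w)$ for all $w\in A^*$; LTS may trace equivalence: $x\equiv^{LTS}_B y$ iff for all $w$, $\{x\}^w\cap X\neq\emptyset\Leftrightarrow\{y\}^w\cap X\neq\emptyset$; LTS must trace equivalence: $x\equiv^{LTS}_T y$ iff for all $w$, $\star\in\{x\}^w\Leftrightarrow\star\in\{y\}^w$. NPLTS semantics (for $t'\colon X\to(\mathcal P\mathcal D X)^A$, finite sets of finitely supported distributions, $\delta_x$ Dirac): terms $s::=x\mid\star\mid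 s\oplus s\mid s+_ps\ (p\in[0,1])$; $\tau(\emptyset)=\star$, $\tau(\{\Delta_1,\dots,\Delta_n\})=d_1\oplus\cdots\oplus d_n$ with $d_i$ a $+_p$-term over $X$ denoting $\Delta_i$ (reading $x$ as $\delta_x$; the semantics does not depend on the choice). For each label $a$: $x^a=\tau(t'(x)(a))$, $\star^a=\star$, $(s_1\oplus s_2)^a=s_1^a\oplus s_2^a$, $(s_1+_ps_2)^a=s_1^a+_ps_2^a$; $s^\varepsilon=s$, $s^{aw}=(s^a)^w$. Outputs: $o_B$: $x\mapsto1$, $\star\mapsto0$, $\oplus\mapsto\max$, $+_p\mapsto p\cdot-+(1-p)\cdot-$; $o_T$: same with $\min$; $o$ into closed intervals of $[0,1]$: $x\mapsto[1,1]$, $\star\mapsto[0,0]$, $\oplus\mapsto[\min$ of lower ends$,\max$ of upper ends$]$, $+_p\mapsto$ endpoint-wise convex combination. $x\equiv y$ iff $o(x^w)=o(y^w)$ for all $w$; $x\equiv_B y$ iff $o_B(x^w)=o_B(y^w)$ for all $w$; $x\equiv_T y$ iff $o_T(x^w)=o_T(y^w)$ for all $w$. *)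

(* Defs.v *)
From HB Require Import structures.
From mathcomp Require Import all_boot all_order all_algebra finmap.
From mathcomp Require Import interval_inference.
From mathcomp Require Import boolp classical_sets reals.
From mathcomp Require Import lra.

Set Implicit Arguments.
Unset Strict Implicit.
Unset Printing Implicit Defensive.

Import Order.TTheory GRing.Theory Num.Theory.

Local Open Scope fset_scope.
Local Open Scope ring_scope.

Section LTS.
Variables (X : choiceType) (A : Type) (t : X -> A -> {fset X}).

(* [option X] encodes X + {star}: [Some x] is the state x, [None] is star. *)
Definition theta (u : option X) (a : A) : {fset option X} :=
  if u is Some x then
    if t x a == fset0 then [fset None] else [fset Some y | y in t x a]
  else [fset None].

Definition lts_step (S : {fset option X}) (a : A) : {fset option X} :=
  \bigcup_(u <- S) theta u a.

Definition lts_run (S : {fset option X}) (w : seq A) : {fset option X} :=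
  foldl lts_step S w.

Definition has_state (S : {fset option X}) : Prop := exists x, Some x \in S.

Inductive observation := Bullet | StarObs.

Definition obs (S : {fset option X}) : set observation :=
  fun b => match b with
           | Bullet => has_state S
           | StarObs => None \in S
           end.

Definition lts_maymust_equiv (x y : X) : Prop :=
  forall w, obs (lts_run [fset Some x] w) = obs (lts_run [fset Some y] w).

Definition lts_may_equiv (x y : X) : Prop :=
  forall w, has_state (lts_run [fset Some x] w) <->
            has_state (lts_run [fset Some y] w).

Definition lts_must_equiv (x y : X) : Prop :=
  forall w, None \in lts_run [fset Some x] w <->
            None \in lts_run [fset Some y] w.

End LTS.

Section Distributions.
Variables (R : realType) (X : choiceType).

Definition is_fdist (f : {fsfun X -> R with 0}) : bool :=
  all (fun x => 0 <= f x) (finsupp f) && (\sum_(x <- finsupp f) f x == 1).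

Record fdist := FDist {
  fdist_val :> {fsfun X -> R with 0};
  fdist_valP : is_fdist fdist_val }.

HB.instance Definition _ := [isSub for fdist_val].
HB.instance Definition _ := [Choice of fdist by <:].

Definition dirac_fun (x : X) : {fsfun X -> R with 0} :=
  [fsfun y in [fset x] => 1 | 0].

Lemma dirac_funE x y : dirac_fun x y = (y == x)%:R.
Proof. by rewrite /dirac_fun fsfunE inE; case: eqP. Qed.

Lemma is_fdist_dirac x : is_fdist (dirac_fun x).
Proof.
have E : finsupp (dirac_fun x) = [fset x].
  by apply/fsetP => y; rewrite mem_finsupp dirac_funE inE pnatr_eq0 eqb0 negbK.
rewrite /is_fdist E big_seq_fset1 dirac_funE !eqxx andbT.
by apply/allP => y _; rewrite dirac_funE ler0n.
Qed.

Definition dirac (x : X) : fdist := FDist (is_fdist_dirac x).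

End Distributions.

(* [Conv p s1 s2] is s1 +_p s2 and [Oplus s1 s2] is s1 (+) s2. *)
Inductive term (R : realType) (X : choiceType) : Type :=
| Var of X
| Star
| Oplus of term R X & term R X
| Conv of {i01 R} & term R X & term R X.

Arguments Var {R X}.
Arguments Star {R X}.

Section Tau.
Variables (R : realType) (X : choiceType).
Implicit Types (s d : term R X) (D : fdist R X).

(* [denotes d D]: d is a term built from variables and the operations +_p
   only, and it evaluates to D when x is read as the Dirac distribution. *)
Inductive denotes : term R X -> fdist R X -> Prop :=
| denotes_Var x : denotes (Var x) (dirac R x)
| denotes_Conv (p : {i01 R}) d1 d2 D1 D2 D :
    denotes d1 D1 -> denotes d2 D2 ->
    (forall x, D x = p%:num * D1 x + (1 - p%:num) * D2 x) ->
    denotes (Conv p d1 d2) D.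

Fixpoint oplus_seq s (ss : seq (term R X)) : term R X :=
  if ss is s' :: ss' then Oplus s (oplus_seq s' ss') else s.

(* The admissible translations tau: the order in which the distributions of a
   set are enumerated and the terms denoting them are left arbitrary. *)
Definition is_tau (tau : {fset fdist R X} -> term R X) : Prop :=
  tau fset0 = Star /\
  forall S, S != fset0 ->
    exists (D : fdist R X) (Ds : seq (fdist R X)) (d : fdist R X -> term R X),
      [/\ uniq (D :: Ds), D :: Ds =i S,
          forall E, E \in S -> denotes (d E) E
        & tau S = oplus_seq (d D) (map d Ds)].

Lemma denotes_exists D : exists d, denotes d D.
Proof.
move: {2}(size (finsupp D)) (leqnn (size (finsupp D))) => n.
elim: n D => [|n IHn] D szD.
  have /andP[_] := fdist_valP D.
  move: szD; rewrite leqn0 size_eq0 => /eqP ->.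
  by rewrite big_nil eq_sym oner_eq0.
have /andP[/allP D0 /eqP D1] := fdist_valP D.
have [x xD] : exists x, x \in finsupp D.
  case E : (finsupp D == fset0); last by apply/fset0Pn; rewrite E.
  by move: D1; rewrite (eqP E) big_seq_fset0 => /eqP; rewrite eq_sym oner_eq0.
have Dx0 : 0 <= D x by apply: D0.
have rest0 : 0 <= \sum_(y <- finsupp D `\ x) D y.
  rewrite big_seq; apply: sumr_ge0 => y.
  by rewrite in_fsetD1 => /andP[_ /D0].
have D1' : D x + \sum_(y <- finsupp D `\ x) D y = 1.
  by rewrite -D1 [RHS](big_fsetD1 x).
have Dx1 : D x <= 1 by rewrite -D1' lerDl.
have [Dx|Dx] := eqVneq (D x) 1.
  exists (Var x); have -> : D = dirac R x; last exact: denotes_Var.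
  apply/val_inj/fsfunP => y /=; rewrite dirac_funE.
  have [->//|yx] := eqVneq y x.
  have R0 : \sum_(y <- finsupp D `\ x) D y == 0 by apply/eqP; lra.
  have [yD|] := boolP (y \in finsupp D); last by move=> /fsfun_dflt.
  move: R0; rewrite big_seq psumr_eq0; last first.
    by move=> z; rewrite in_fsetD1 => /andP[_ /D0].
  move=> /allP /(_ y); rewrite in_fsetD1 yx yD /= => /(_ isT).
  by move/eqP.
have q0 : 0 < 1 - D x by rewrite subr_gt0 lt_neqAle Dx.
pose g : {fsfun X -> R with 0} :=
  [fsfun y in finsupp D `\ x => D y / (1 - D x) | 0].
have gE y : g y = if y == x then 0 else D y / (1 - D x).
  rewrite /g fsfunE in_fsetD1; case: eqVneq => //= _.
  by case: (finsuppP D y) => // _; rewrite mul0r.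
have gS : finsupp g = finsupp D `\ x.
  apply/fsetP => y; rewrite mem_finsupp gE in_fsetD1 mem_finsupp.
  have [->|_] /= := eqVneq y x; first by rewrite eqxx.
  by rewrite mulf_eq0 invr_eq0 (gt_eqF q0) orbF.
have gP : is_fdist g.
  rewrite /is_fdist gS; apply/andP; split.
    apply/allP => y; rewrite in_fsetD1 gE => /andP[/negPf -> /D0 Dy].
    by rewrite divr_ge0 // ltW.
  rewrite big_seq (eq_bigr (fun y => D y / (1 - D x))); last first.
    by move=> y; rewrite in_fsetD1 gE => /andP[/negPf ->].
  rewrite -big_seq -mulr_suml; apply/eqP.
  have -> : \sum_(y <- finsupp D `\ x) D y = 1 - D x by lra.
  by rewrite divff // gt_eqF.
have [|e De] := IHn (FDist gP).
  rewrite /= gS; move: szD; rewrite (cardfsD1 x) xD add1n ltnS.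
  exact.
exists (Conv (Itv01 Dx0 Dx1) (Var x) e).
apply: (denotes_Conv (denotes_Var x) De) => y /=.
rewrite dirac_funE gE; have [->|_] := eqVneq y x; first by rewrite mulr1 mulr0 addr0.
by rewrite mulr0 add0r mulrC divfK // gt_eqF.
Qed.

Lemma is_tau_exists : exists tau, is_tau tau.
Proof.
have [d dP] : exists d : fdist R X -> term R X, forall D, denotes (d D) D.
  by exists (fun D => sval (cid (denotes_exists D))) => D; case: cid.
exists (fun S => if enum_fset S is D :: Ds then oplus_seq (d D) (map d Ds)
                 else Star).
split=> [|S S0].
  case E : (enum_fset fset0) => [//|D Ds].
  have : D \in enum_fset fset0 by rewrite E mem_head.
  by rewrite -[_ \in _]/(D \in fset0) in_fset0.
case E : (enum_fset S) => [|D Ds].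
  by case/fset0Pn: S0 => D; rewrite -[_ \in S]/(D \in enum_fset S) E.
exists D, Ds, d; split=> //; first by rewrite -E fset_uniq.
by move=> D'; rewrite -E.
Qed.

End Tau.

Section Outputs.
Variables (R : realType) (X : choiceType).

(* Closed subintervals of [0, 1], given by their pair of endpoints. *)
Definition is_subitv (I : R * R) : bool := [&& 0 <= I.1, I.1 <= I.2 & I.2 <= 1].

Record subitv := SubItv { ends :> R * R; endsP : is_subitv ends }.

HB.instance Definition _ := [isSub for ends].
HB.instance Definition _ := [Choice of subitv by <:].

Lemma is_subitv_one : is_subitv (1, 1).
Proof. by rewrite /is_subitv /= ler01 lexx. Qed.

Lemma is_subitv_zero : is_subitv (0, 0).
Proof. by rewrite /is_subitv /= ler01 lexx. Qed.

Lemma is_subitv_hull (I J : subitv) :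
  is_subitv (Num.min I.1 J.1, Num.max I.2 J.2).
Proof.
case: I J => -[a b] /and3P[/= a0 ab b1] [[c d] /and3P[/= c0 cd d1]].
apply/and3P; split => /=.
- by rewrite le_min a0 c0.
- by rewrite ge_min !le_max ab.
- by rewrite ge_max b1 d1.
Qed.

Lemma is_subitv_conv (p : {i01 R}) (I J : subitv) :
  is_subitv (p%:num * I.1 + (1 - p%:num) * J.1,
             p%:num * I.2 + (1 - p%:num) * J.2).
Proof.
case: I J => -[a b] /and3P[/= a0 ab b1] [[c d] /and3P[/= c0 cd d1]].
have p0 : 0 <= p%:num by [].
have p1 : 0 <= 1 - p%:num by rewrite subr_ge0.
by apply/and3P; split => /=; nra.
Qed.

Definition itv_one : subitv := SubItv is_subitv_one.
Definition itv_zero : subitv := SubItv is_subitv_zero.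
Definition itv_hull (I J : subitv) : subitv := SubItv (is_subitv_hull I J).
Definition itv_conv (p : {i01 R}) (I J : subitv) : subitv :=
  SubItv (is_subitv_conv p I J).

Fixpoint out (s : term R X) : subitv :=
  match s with
  | Var _ => itv_one
  | Star => itv_zero
  | Oplus s1 s2 => itv_hull (out s1) (out s2)
  | Conv p s1 s2 => itv_conv p (out s1) (out s2)
  end.

Fixpoint out_may (s : term R X) : R :=
  match s with
  | Var _ => 1
  | Star => 0
  | Oplus s1 s2 => Num.max (out_may s1) (out_may s2)
  | Conv p s1 s2 => p%:num * out_may s1 + (1 - p%:num) * out_may s2
  end.

Fixpoint out_must (s : term R X) : R :=
  match s with
  | Var _ => 1
  | Star => 0
  | Oplus s1 s2 => Num.min (out_must s1) (out_must s2)
  | Conv p s1 s2 => p%:num * out_must s1 + (1 - p%:num) * out_must s2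
  end.

End Outputs.

Section NPLTS.
Variables (R : realType) (X : choiceType) (A : Type).
Variables (tau : {fset fdist R X} -> term R X).
Variables (t' : X -> A -> {fset fdist R X}).

Fixpoint nplts_step (s : term R X) (a : A) : term R X :=
  match s with
  | Var x => tau (t' x a)
  | Star => Star
  | Oplus s1 s2 => Oplus (nplts_step s1 a) (nplts_step s2 a)
  | Conv p s1 s2 => Conv p (nplts_step s1 a) (nplts_step s2 a)
  end.

Definition nplts_run (s : term R X) (w : seq A) : term R X :=
  foldl nplts_step s w.

Definition nplts_maymust_equiv (x y : X) : Prop :=
  forall w, out (nplts_run (Var x) w) = out (nplts_run (Var y) w).

Definition nplts_may_equiv (x y : X) : Prop :=
  forall w, out_may (nplts_run (Var x) w) = out_may (nplts_run (Var y) w).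

Definition nplts_must_equiv (x y : X) : Prop :=
  forall w, out_must (nplts_run (Var x) w) = out_must (nplts_run (Var y) w).

End NPLTS.

Definition nplts_of_lts (R : realType) (X : choiceType) (A : Type)
    (t : X -> A -> {fset X}) (x : X) (a : A) : {fset fdist R X} :=
  [fset dirac R x' | x' in t x a].

(* Main.v *)
(* The output of a run of [s] is the value of the term [s] when each variable x
   is assigned the output of the run of x. On a term denoting a Dirac
   distribution at x this value is the one assigned to x, so by induction on the
   word all outputs of the NPLTS are 0 or 1: after a w, the may output of x is
   the disjunction over the a-successors of their may outputs after w, and the
   must output is the corresponding conjunction (0 if there is no a-successor).
   Membership in the runs of the LTS obeys the same recursions. *)
Require Import Defs.
From mathcomp Require Import all_boot all_order all_algebra finmap reals.
From mathcomp Require Import interval_inference boolp.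

Set Implicit Arguments.
Unset Strict Implicit.
Unset Printing Implicit Defensive.

Import Order.TTheory GRing.Theory Num.Theory.

Local Open Scope fset_scope.
Local Open Scope ring_scope.

(** * Runs of the labelled transition system *)

Section LTSRuns.
Variables (X : choiceType) (A : Type) (t : X -> A -> {fset X}).
Implicit Types (S : {fset option X}) (u v : option X) (x y : X) (w : seq A).

Fixpoint can_run x w : bool :=
  if w is a :: w' then has (fun y => can_run y w') (t x a) else true.

(** No path from [x] along a proper prefix of [w] ends in a state that lacks a successor for the
    next letter. Such a state would move to star. *)
Fixpoint cannot_stop x w : bool :=
  if w is a :: w' then
    (t x a != fset0) && all (fun y => cannot_stop y w') (t x a)
  else true.

Lemma lts_stepP S a v :
  reflect (exists2 u, u \in S & v \in theta t u a) (v \in lts_step t S a).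
Proof.
apply: (iffP (bigfcupP _ _ _ _)) => [[u /andP[uS _] vu]|[u uS vu]].
  by exists u.
by exists u; rewrite ?uS.
Qed.

Lemma lts_step1 u a : lts_step t [fset u] a = theta t u a.
Proof. by rewrite /lts_step big_seq_fset1. Qed.

(** Each step is a union over the elements of the set, so runs preserve unions. This reduces runs to
    singletons. *)
Lemma lts_run_bigcup S w v :
  (exists2 u, u \in S & v \in lts_run t [fset u] w) <-> v \in lts_run t S w.
Proof.
elim: w S => [|a w IHw] S /=.
  by split=> [[u uS /fset1P ->]//|vS]; exists v; rewrite ?inE.
rewrite -IHw; split=> [[u uS]|[u' /lts_stepP[u uS u'u] vu']].
  rewrite lts_step1 -IHw => -[u' u'u vu'].
  by exists u' => //; apply/lts_stepP; exists u.
by exists u => //; rewrite lts_step1 -IHw; exists u'.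
Qed.

Lemma lts_run_star w : lts_run t [fset None] w = [fset None].
Proof. by elim: w => //= a w IHw; rewrite lts_step1. Qed.

(** Star is absorbing, so a state without [a]-successors yields only star, whatever [w] is. *)
Lemma lts_run_cons x a w v :
  v \in lts_run t [fset Some x] (a :: w) <->
  if t x a == fset0 then v = None
  else exists2 y, y \in t x a & v \in lts_run t [fset Some y] w.
Proof.
rewrite /= lts_step1 /=; case: ifP => _.
  by rewrite lts_run_star; split=> [/fset1P|->]; rewrite ?inE.
rewrite -lts_run_bigcup; split=> [[_ /imfsetP[y /= yt ->]] vy|[y yt vy]].
  by exists y.
by exists (Some y) => //; apply/imfsetP; exists y.
Qed.

Lemma has_state_lts_run x w :
  has_state (lts_run t [fset Some x] w) <-> can_run x w.
Proof.
elim: w x => [|a w IHw] x; first by split=> // _; exists x; rewrite inE.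
split=> [[z /lts_run_cons]|/hasP[y yt /IHw[z zy]]].
  case: ifP => [//|_ [y yt zy]].
  by apply/hasP; exists y => //; apply/IHw; exists z.
exists z; apply/lts_run_cons; case: ifP => [/eqP t0|_]; last by exists y.
by rewrite t0 in yt.
Qed.

Lemma star_lts_run x w :
  (None \in lts_run t [fset Some x] w) = ~~ cannot_stop x w.
Proof.
elim: w x => [|a w IHw] x; first by rewrite inE.
apply/idP/idP => [/lts_run_cons|] /=.
  case: ifP => //= _ [y yt]; rewrite IHw => yw.
  by apply/allPn; exists y.
move=> H; apply/lts_run_cons; case: ifP H => //= _ /allPn[y yt yw].
by exists y; rewrite ?IHw.
Qed.

End LTSRuns.

(** * Values of terms under an assignment of the variables *)

Section TermEval.
Variables (R : realType) (X : choiceType) (op : R -> R -> R).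
Implicit Types (f : X -> R) (s : term R X) (D : fdist R X).

Fixpoint term_eval f s : R :=
  match s with
  | Var x => f x
  | Star => 0
  | Oplus s1 s2 => op (term_eval f s1) (term_eval f s2)
  | Conv p s1 s2 => p%:num * term_eval f s1 + (1 - p%:num) * term_eval f s2
  end.

(** [nplts_step] commutes with all term operations, so a run of [s] is [s] with each variable
    replaced by its own run. This allows induction on the word from its first letter. *)
Lemma term_eval_run (A : Type) tau (t' : X -> A -> {fset fdist R X}) f s w :
  term_eval f (nplts_run tau t' s w) =
  term_eval (fun x => term_eval f (nplts_run tau t' (Var x) w)) s.
Proof.
elim: s => [x| |s1 IH1 s2 IH2|p s1 IH1 s2 IH2] //=.
- by elim: w.
- by rewrite -IH1 -IH2; elim: w s1 s2 {IH1 IH2} => /=.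
- by rewrite -IH1 -IH2; elim: w s1 s2 {IH1 IH2} => /=.
Qed.

Lemma fdist_ge0 D x : 0 <= D x.
Proof.
have /andP[/allP D0 _] := fdist_valP D.
by case: (finsuppP D x) => // /D0.
Qed.

Lemma fdist_eq_dirac D x : (forall y, y != x -> D y = 0) -> D = dirac R x.
Proof.
move=> D0; have /andP[_ /eqP D1] := fdist_valP D.
have sD : finsupp D `<=` [fset x].
  apply/fsubsetP => y; rewrite mem_finsupp inE.
  by apply: contraNT => /D0 ->.
apply/val_inj/fsfunP => y /=; rewrite dirac_funE.
have [->|/D0 //] := eqVneq y x.
rewrite -[RHS]D1 (big_fset_incl _ sD) ?big_seq_fset1 // => z _.
exact: fsfun_dflt.
Qed.

(* A subterm of weight 0 may denote any distribution, hence the case split on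
   [p] being 0 or 1. *)
Lemma term_eval_dirac f d x : denotes d (dirac R x) -> term_eval f d = f x.
Proof.
move E : (dirac R x) => D dD.
elim: dD x E => {d D} [y|p d1 d2 D1 D2 D _ IH1 _ IH2 DE] x E /=.
  move/(congr1 (fun D : fdist R X => D y)): E => /=.
  rewrite !dirac_funE eqxx; case: eqVneq => [->//|_] /eqP.
  by rewrite eq_sym oner_eq0.
(* Off [x] two nonnegative summands add up to 0, so both vanish; a branch of nonzero weight is then
   itself Dirac at [x]. *)
have DE' y : y != x -> p%:num * D1 y = 0 /\ (1 - p%:num) * D2 y = 0.
  move=> yx; have := DE y; rewrite -E /= dirac_funE (negPf yx) => /esym/eqP.
  have p0 : 0 <= p%:num by [].
  have p1 : 0 <= 1 - p%:num by rewrite subr_ge0.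
  by rewrite paddr_eq0 ?mulr_ge0 ?fdist_ge0 // => /andP[/eqP -> /eqP ->].
have H1 : p%:num != 0 -> term_eval f d1 = f x.
  move=> p0; apply/IH1/esym/fdist_eq_dirac => y /DE'[/eqP + _].
  by rewrite mulf_eq0 (negPf p0) => /eqP.
have H2 : 1 - p%:num != 0 -> term_eval f d2 = f x.
  move=> p1; apply/IH2/esym/fdist_eq_dirac => y /DE'[_ /eqP].
  by rewrite mulf_eq0 (negPf p1) => /eqP.
have [p0|p0] := eqVneq p%:num 0.
  by rewrite p0 mul0r add0r subr0 mul1r H2 // p0 subr0 oner_eq0.
have [p1|p1] := eqVneq (1 - p%:num) 0.
  by rewrite p1 mul0r addr0 -(subr0_eq p1) mul1r H1 // -(subr0_eq p1) oner_eq0.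
by rewrite H1 // H2 // -mulrDl subrKC mul1r.
Qed.

End TermEval.

(** * Values of the translated sets of Dirac distributions *)

Section TauEval.
Variables (R : realType) (X : choiceType) (tau : {fset fdist R X} -> term R X).
Hypothesis htau : is_tau tau.
Implicit Types (S : {fset X}) (b : pred X).

(** Since [dirac] is injective, the enumeration of distributions behind [tau] can be reindexed by
    states. *)
Lemma tau_diracs S : S != fset0 ->
  exists (x : X) (xs : seq X) (d : X -> term R X),
    [/\ x :: xs =i S, forall y, y \in S -> denotes (d y) (dirac R y)
      & tau [fset dirac R y | y in S] = oplus_seq (d x) (map d xs)].
Proof.
case/fset0Pn => x0 x0S.
have diracS y : y \in S -> dirac R y \in [fset dirac R y | y in S].
  by move=> yS; apply/imfsetP; exists y.
have [|D [Ds [d [_ DS dP tauE]]]] := htau.2 [fset dirac R y | y in S].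
  by apply/fset0Pn; exists (dirac R x0); apply: diracS.
have dirac_inj : injective (@dirac R X).
  move=> y z /(congr1 (fun E : fdist R X => E y)) /=.
  rewrite !dirac_funE eqxx; case: eqVneq => // _ /eqP.
  by rewrite oner_eq0.
(* [g] inverts [dirac] on the enumerated distributions; elsewhere it takes the junk value [x0]. *)
have [g gK] : exists g : fdist R X -> X,
    {in D :: Ds, forall E, g E \in S /\ dirac R (g E) = E}.
  pose P E y := y \in S /\ dirac R y = E.
  have /choice[g gP] : forall E, exists y, E \in D :: Ds -> P E y.
    move=> E; have [|nE] := boolP (E \in D :: Ds); last by exists x0.
    by rewrite DS => /imfsetP[y /= yS ->]; exists y.
  by exists g.
exists (g D), (map g Ds), (d \o @dirac R X); split.
- move=> y; rewrite -[g D :: _]/(map g (D :: Ds)).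
  apply/mapP/idP => [[E /gK[gES _] ->]//|yS].
  have yD : dirac R y \in D :: Ds by rewrite DS diracS.
  by exists (dirac R y) => //; apply: dirac_inj; rewrite (gK _ yD).2.
- by move=> y yS; apply/dP/diracS.
- rewrite tauE /= (gK _ (mem_head _ _)).2 -map_comp; congr oplus_seq.
  apply/eq_in_map => E EDs /=.
  by rewrite (gK E _).2 // inE EDs orbT.
Qed.

Lemma max_nat_of_bool (b1 b2 : bool) :
  Num.max (b1%:R : R) b2%:R = (b1 || b2)%:R.
Proof. by rewrite -natr_max; case: b1 b2 => [] []. Qed.

Lemma min_nat_of_bool (b1 b2 : bool) :
  Num.min (b1%:R : R) b2%:R = (b1 && b2)%:R.
Proof. by rewrite -natr_min; case: b1 b2 => [] []. Qed.

Lemma max_eval_tau b S :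
  term_eval Num.max (fun x => (b x)%:R) (tau [fset dirac R y | y in S]) =
  (has b S)%:R.
Proof.
have [->|/tau_diracs[x [xs [d [xsS dP ->]]]]] := eqVneq S fset0.
  by rewrite imfset0 htau.1; case: (boolP (has _ _)) => // /hasP[].
have {}dP : {in x :: xs, forall y, denotes (d y) (dirac R y)}.
  by move=> y; rewrite xsS => /dP.
rewrite -(eq_has_r xsS).
elim: xs x dP {xsS} => [|x' xs IHxs] x dP /=.
  by rewrite orbF (term_eval_dirac _ _ (dP x (mem_head _ _))).
rewrite (term_eval_dirac _ _ (dP x (mem_head _ _))) IHxs ?max_nat_of_bool //.
by move=> y yxs; apply: dP; rewrite inE yxs orbT.
Qed.

(** The empty set translates to [Star], of value 0, whereas an empty conjunction is true; hence the
    conjunct [S != fset0]. *)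
Lemma min_eval_tau b S :
  term_eval Num.min (fun x => (b x)%:R) (tau [fset dirac R y | y in S]) =
  ((S != fset0) && all b S)%:R.
Proof.
have [->|/tau_diracs[x [xs [d [xsS dP ->]]]]] := eqVneq S fset0.
  by rewrite imfset0 htau.1.
have {}dP : {in x :: xs, forall y, denotes (d y) (dirac R y)}.
  by move=> y; rewrite xsS => /dP.
rewrite -(eq_all_r xsS).
elim: xs x dP {xsS} => [|x' xs IHxs] x dP /=.
  by rewrite andbT (term_eval_dirac _ _ (dP x (mem_head _ _))).
rewrite (term_eval_dirac _ _ (dP x (mem_head _ _))) IHxs ?min_nat_of_bool //.
by move=> y yxs; apply: dP; rewrite inE yxs orbT.
Qed.

End TauEval.

(** * Outputs of runs and comparison of the equivalences *)

Section Outputs.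
Variables (R : realType) (X : choiceType).
Implicit Types s : term R X.

Lemma out_mayE s : out_may s = term_eval Num.max (fun=> 1) s.
Proof. by elim: s => //= [s1 -> s2 ->|p s1 -> s2 ->]. Qed.

Lemma out_mustE s : out_must s = term_eval Num.min (fun=> 1) s.
Proof. by elim: s => //= [s1 -> s2 ->|p s1 -> s2 ->]. Qed.

(** No operation on intervals mixes lower and upper ends, so the two ends evolve separately. *)
Lemma ends_out s : ends (out s) = (out_must s, out_may s).
Proof. by elim: s => //= [s1 -> s2 ->|p s1 -> s2 ->]. Qed.

Variables (A : Type) (t : X -> A -> {fset X}).
Variable tau : {fset fdist R X} -> term R X.
Hypothesis htau : is_tau tau.
Local Notation run := (nplts_run tau (nplts_of_lts R t)).

Lemma out_may_run x w : out_may (run (Var x) w) = (can_run t x w)%:R.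
Proof.
rewrite out_mayE; elim: w x => [//|a w IHw] x.
rewrite -[run _ _]/(run (tau (nplts_of_lts R t x a)) w) term_eval_run.
(* The induction hypothesis makes the assignment of the variables 0/1-valued, as [max_eval_tau]
   requires. *)
under [fun _ : X => _]funext do rewrite IHw.
exact: max_eval_tau.
Qed.

Lemma out_must_run x w : out_must (run (Var x) w) = (cannot_stop t x w)%:R.
Proof.
rewrite out_mustE; elim: w x => [//|a w IHw] x.
rewrite -[run _ _]/(run (tau (nplts_of_lts R t x a)) w) term_eval_run.
under [fun _ : X => _]funext do rewrite IHw.
exact: min_eval_tau.
Qed.

Lemma may_equivP x y :
  lts_may_equiv t x y <-> nplts_may_equiv tau (nplts_of_lts R t) x y.
Proof.
split=> E w; have := E w; rewrite !has_state_lts_run !out_may_run.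
  by move=> H; congr (nat_of_bool _)%:R; apply/idP/idP => /H.
by move=> /eqP; rewrite eqr_nat; case: (can_run t x w); case: (can_run t y w).
Qed.

Lemma must_equivP x y :
  lts_must_equiv t x y <-> nplts_must_equiv tau (nplts_of_lts R t) x y.
Proof.
split=> E w; have := E w; rewrite !star_lts_run !out_must_run.
  (* Star is reached exactly when [cannot_stop] fails, so the equivalence is used in contrapositive
     form. *)
  by move=> H; congr (nat_of_bool _)%:R; apply/idP/idP; apply: contraLR => /H.
by move=> /eqP; rewrite eqr_nat; case: (cannot_stop t x w); case: (cannot_stop t y w).
Qed.

Lemma lts_maymust_equivE x y :
  lts_maymust_equiv t x y <-> lts_may_equiv t x y /\ lts_must_equiv t x y.
Proof.
split=> [E|[Emay Emust] w].
  split=> w; first by have /(congr1 (@^~ Bullet)) /= -> := E w.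
  by have /(congr1 (@^~ StarObs)) /= -> := E w.
by apply/funext => -[]; apply/propext; [apply: Emay|apply: Emust].
Qed.

Lemma nplts_maymust_equivE t' x y :
  nplts_maymust_equiv (A := A) tau t' x y <->
  nplts_may_equiv tau t' x y /\ nplts_must_equiv tau t' x y.
Proof.
split=> [E|[Emay Emust] w]; last first.
  by apply: val_inj; rewrite /= !ends_out Emay Emust.
by split=> w; have /(congr1 (@ends R)) := E w; rewrite !ends_out => -[].
Qed.

End Outputs.

Theorem theorem7p9 (R : realType) (X : choiceType) (A : Type)
    (t : X -> A -> {fset X})
    (tau : {fset fdist R X} -> term R X) (htau : is_tau tau) :
  [/\ forall x y : X,
        lts_maymust_equiv t x y <->
        nplts_maymust_equiv tau (nplts_of_lts R t) x y,
      forall x y : X,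
        lts_may_equiv t x y <-> nplts_may_equiv tau (nplts_of_lts R t) x y
    & forall x y : X,
        lts_must_equiv t x y <-> nplts_must_equiv tau (nplts_of_lts R t) x y].
Proof.
split=> x y; [|exact: may_equivP|exact: must_equivP].
(* On both sides the may-must equivalence is the conjunction of the may and the must equivalence. *)
rewrite lts_maymust_equivE nplts_maymust_equivE.
by rewrite (may_equivP t htau) (must_equivP t htau).
Qed.
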